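(* Let $n\geq 1$ and let $\mathcal{A}$ be a commuting family of $n\times n$ complex matrices (any two elements of $\mathcal{A}$ commute; $\mathcal{A}$ may be infinite) such that $\sigma(T)\subset\overline{\mathbb{D}}$ for every $T\in\mathcal{A}$. Then there are finitely many non-zero subspaces $V_1,\ldots,V_s\subset\mathbb{C}^n$ with the following properties: (a) for each $1\leq i\leq s$, the subspace $V_i$ is invariant for $\mathcal{A}$, that is, $TV_i\subset V_i$ for every $T\in\mathcal{A}$; (b) $V_i\cap\left(\sum_{j\neq i}V_j\right)=\{0\}$ for every $1\leq i\leq s$, and $\mathbb{C}^n=\sum_{i=1}^s V_i$; (c) for each $1\leq i\leq s$ and each $T\in\mathcal{A}$, either $\sigma(T|_{V_i})\subset\Delta(T)$ or there is $z\in\overline{\mathbb{D}}$ such that $T|_{V_i}=zI_{V_i}$.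
   Context: $\mathbb{D}$ is the open unit disc in $\mathbb{C}$ and $\overline{\mathbb{D}}$ its closure. $\sigma(T)$ denotes the set of eigenvalues of $T$. For an $n\times n$ complex matrix (or a linear operator on a finite-dimensional complex vector space) $T$, $\Delta(T)\subset\sigma(T)$ denotes the set of those eigenvalues $\lambda$ that appear in a Jordan block of size at least $2$ in the Jordan canonical form of $T$; equivalently, $\lambda\in\Delta(T)$ if and only if $\ker(T-\lambda I)\neq\ker(T-\lambda I)^2$. $I_V$ is the identity operator on $V$. *)

(* Defs.v *)
From HB Require Import structures.
From mathcomp Require Import all_boot all_order all_algebra.
From mathcomp Require Import reals.
From mathcomp Require Export complex.

Set Implicit Arguments.
Unset Strict Implicit.
Unset Printing Implicit Defensive.

Import Order.TTheory GRing.Theory Num.Theory.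
Local Open Scope ring_scope.

(* The operator v |-> T v on column vectors; all spectral notions are those of
   this operator. *)
Definition mxop (F : fieldType) (n : nat) (T : 'M[F]_n) : 'End('cV[F]_n) :=
  linfun (mulmx T).

(* When f does not leave U invariant, this is the compression of f to U; it is
   the restriction f|_U as soon as (f @: U <= U)%VS, see [lrestrE]. *)
Definition lrestr (F : fieldType) (vT : vectType F) (f : 'End(vT))
    (U : {vspace vT}) : 'End(subvs_of U) :=
  linfun (vsproj U \o f \o vsval).

Lemma lrestrE (F : fieldType) (vT : vectType F) (f : 'End(vT))
    (U : {vspace vT}) (u : subvs_of U) :
  (f @: U <= U)%VS -> vsval (lrestr f U u) = f (vsval u).
Proof.
by move=> fU; rewrite lfunE /= vsprojK // (subvP fU) // memv_img // subvsP.
Qed.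

(* The eigenvalues of f occurring in a Jordan block of size at least 2, through
   the criterion ker (f - a) <> ker (f - a)^2. *)
Definition Delta (F : fieldType) (vT : vectType F) (f : 'End(vT)) (a : F) : bool :=
  let g := (f - a *: \1)%VF in lker g != lker (g \o g)%VF.

Lemma Delta_leigenvalue (F : fieldType) (vT : vectType F) (f : 'End(vT)) (a : F) :
  Delta f a -> passmx.leigenvalue f a.
Proof.
rewrite /Delta /passmx.leigenvalue /passmx.leigenspace /=; apply: contraNneq => ker0.
have g_inj v : (f - a *: \1)%VF v = 0 -> v = 0.
  by move/eqP; rewrite -memv_ker ker0 memv0 => /eqP.
apply/eqP/vspaceP => v; rewrite !memv_ker comp_lfunE.
by apply/eqP/eqP => [->|/g_inj//]; rewrite linear0.
Qed.

(* Main.v *)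
(* If U is invariant, a is an eigenvalue of T on U outside Delta(T) and
   g := T - a, then ker g = ker g^2 on the whole space gives
   U = (U :&: ker g) + g(U), a direct sum of subspaces invariant under every
   matrix commuting with T. Both summands are non-zero unless T is the scalar a
   on U, so splitting as long as possible yields the decomposition. *)

Require Import Defs.
From mathcomp Require Import all_boot all_order all_algebra.
From mathcomp Require Import boolp reals.
Import Order.TTheory GRing.Theory Num.Theory.
Local Open Scope ring_scope.

(** Strong induction on [\dim U]: two non-zero summands with trivial intersection both have smaller
    dimension, and the lists obtained for them are concatenated. Directness is recorded as an
    equality of dimensions because this form is additive under concatenation. *)
Lemma exists_direct_decomposition (F : fieldType) (vT : vectType F)
    (P Q : {vspace vT} -> Prop) :
  (forall U, P U -> U != 0%VS ->
     Q U \/ exists U1 U2, [/\ P U1 /\ P U2, U1 != 0%VS, U2 != 0%VS,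
                             (U1 :&: U2)%VS = 0%VS & (U1 + U2)%VS = U]) ->
  forall U, P U -> exists s : seq {vspace vT},
    [/\ forall W, W \in s -> [/\ W != 0%VS, P W & Q W],
        (\sum_(W <- s) W)%VS = U & (\sum_(W <- s) \dim W)%N = \dim U].
Proof.
move=> split_or U; have [m] := ubnP (\dim U).
elim: m U => // m IHm U /ltnSE leUm PU.
have [->|U0] := eqVneq U 0%VS.
  by exists [::]; rewrite !big_nil dimv0; split.
case: (split_or U PU U0) => [QU | [U1 [U2 [[PU1 PU2] nz1 nz2 dx12 defU]]]].
  exists [:: U]; rewrite !big_seq1; split=> // W.
  by rewrite inE => /eqP->.
have dimU : (\dim U1 + \dim U2)%N = \dim U by rewrite -defU dimv_disjoint_sum.
have lt1 : (\dim U1 < \dim U)%N.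
  by rewrite -dimU -[ltnLHS]addn0 ltn_add2l lt0n dimv_eq0.
have lt2 : (\dim U2 < \dim U)%N.
  by rewrite -dimU -[ltnLHS]add0n ltn_add2r lt0n dimv_eq0.
have [s1 [s1P sum1 dim1]] := IHm U1 (leq_trans lt1 leUm) PU1.
have [s2 [s2P sum2 dim2]] := IHm U2 (leq_trans lt2 leUm) PU2.
exists (s1 ++ s2); rewrite !big_cat /= sum1 sum2 dim1 dim2; split=> // W.
by rewrite mem_cat => /orP[/s1P|/s2P].
Qed.

Arguments exists_direct_decomposition {F vT}.

(** An eigenvector of the restriction, viewed in the ambient space through [vsval], is a non-zero
    element of the intersection. *)
Lemma leigenvalue_lrestr_cap (F : fieldType) (vT : vectType F) (f : 'End(vT))
    (U : {vspace vT}) (a : F) :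
  (f @: U <= U)%VS ->
  passmx.leigenvalue (lrestr f U) a -> (U :&: lker (f - a *: \1%VF))%VS != 0%VS.
Proof.
move=> fU; rewrite /passmx.leigenvalue /passmx.leigenspace; apply: contraNneq => UK0.
apply/eqP/vspaceP => u; rewrite memv0 memv_ker.
apply/eqP/eqP => [fu|->]; last by rewrite linear0.
apply/val_inj; apply/eqP; rewrite linear0 -memv0 -UK0 memv_cap subvsP memv_ker.
move/eqP: fu; rewrite !(add_lfunE, opp_lfunE, scale_lfunE, id_lfunE).
by rewrite !subr_eq0 -lrestrE // => /eqP->.
Qed.

Arguments leigenvalue_lrestr_cap {F vT f U a}.

Theorem theorem1p1 (R : realType) (n : nat) (n_gt0 : (0 < n)%N)
    (A : 'M[R[i]]_n -> Prop)
    (A_comm : forall S T : 'M[R[i]]_n, A S -> A T -> S *m T = T *m S)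
    (A_disc : forall T : 'M[R[i]]_n, A T ->
       forall a : R[i], passmx.leigenvalue (mxop T) a -> `|a| <= 1) :
  exists (s : nat) (V : 'I_s -> {vspace 'cV[R[i]]_n}),
    [/\ forall i, V i != 0%VS,
        forall i (T : 'M[R[i]]_n), A T -> (mxop T @: V i <= V i)%VS,
        (forall i, (V i :&: \sum_(j | j != i) V j)%VS = 0%VS)
          /\ fullv = (\sum_i V i)%VS
      & forall i (T : 'M[R[i]]_n), A T ->
          (forall a : R[i], passmx.leigenvalue (lrestr (mxop T) (V i)) a ->
             Delta (mxop T) a)
          \/ (exists2 z : R[i], `|z| <= 1 &
                lrestr (mxop T) (V i) = z *: \1%VF)].
Proof.
pose P (U : {vspace 'cV[R[i]]_n}) := forall T, A T -> (mxop T @: U <= U)%VS.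
pose Q (U : {vspace 'cV[R[i]]_n}) := forall T, A T ->
  (forall a : R[i], passmx.leigenvalue (lrestr (mxop T) U) a ->
     Delta (mxop T) a)
  \/ (exists2 z : R[i], `|z| <= 1 & lrestr (mxop T) U = z *: \1%VF).
have Pfull : P fullv by move=> T _; apply: subvf.
have [|s [sP sum_s dim_s]] := exists_direct_decomposition P Q _ fullv Pfull.
  move=> U PU U0; have [QU|nQU] := EM (Q U); [by left | right].
  (* Classically, the failure of [Q U] provides one [T] that is not an admissible scalar on [U] and
     has there an eigenvalue [a] outside [Delta]; this pair drives the splitting. *)
  have [T [AT [a [eig_a nDa nscal]]]] : exists T, A T /\ exists a,
      [/\ passmx.leigenvalue (lrestr (mxop T) U) a, ~ Delta (mxop T) a
        & ~ exists2 z, `|z| <= 1 & lrestr (mxop T) U = z *: \1%VF].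
    apply: contrapT => noT; apply: nQU => T AT.
    have [|nscal] := EM (exists2 z, `|z| <= 1 & lrestr (mxop T) U = z *: \1%VF).
      by right.
    left=> a eig_a; apply: contrapT => nDa; apply: noT.
    by exists T; split=> //; exists a.
  have memU S v : A S -> v \in U -> S *m v \in U.
    by move=> /PU/subvP US Uv; rewrite -[S *m v](lfunE (mulmx S)) US ?memv_img.
  have UK0 := leigenvalue_lrestr_cap (PU T AT) eig_a.
  set g := (mxop T - a *: \1%VF)%VF in UK0.
  have kerg2 v : g (g v) = 0 -> g v = 0.
    move/negP: nDa; rewrite /Delta -/g negbK => /eqP kergg.
    by move/eqP; rewrite -comp_lfunE -memv_ker -kergg memv_ker => /eqP.
  have gE v : g v = T *m v - a *: v by rewrite add_lfunE opp_lfunE scale_lfunE id_lfunE lfunE.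
  have gcomm S v : A S -> g (S *m v) = S *m g v.
    by move=> AS; rewrite !gE mulmxBr !mulmxA -scalemxAr (A_comm _ _ AS AT).
  (* If [v = g w] and [g v = 0], then [g (g w) = 0], so [kerg2] gives [v = g w = 0]. *)
  have dxU : ((U :&: lker g) :&: (g @: U))%VS = 0%VS.
    apply/eqP; rewrite -subv0; apply/subvP => v; rewrite memv_cap.
    case/andP=> /memv_capP[_]; rewrite memv_ker memv0 => /eqP gv0.
    by case/memv_imgP=> w _ vE; move: gv0; rewrite vE => /kerg2->.
  have gU : (g @: U <= U)%VS.
    apply/subvP => _ /memv_imgP[v Uv ->].
    by rewrite gE memvB ?memvZ ?memU.
  exists (U :&: lker g)%VS, (g @: U)%VS; split=> //.
  (* Each [S] in the family preserves [U] and commutes with [g], hence preserves both the kernel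
     part and the image part. *)
  - split=> S AS; apply/subvP => _ /memv_imgP[v + ->].
      case/memv_capP=> Uv; rewrite memv_ker => /eqP gv0.
      by rewrite [mxop S v]lfunE memv_cap memv_ker memU // gcomm // gv0 mulmx0 eqxx.
    by case/memv_imgP=> w Uw ->; rewrite [mxop S _]lfunE /= -gcomm // memv_img ?memU.
  (* If [g] vanished on [U], [T] would be the scalar [a] there. The bound on [a] comes from
     [A_disc], since a non-zero [U :&: lker g] makes [a] an eigenvalue of [T] on the whole space. *)
  - apply/eqP => gU0; apply: nscal; exists a.
      apply: (A_disc T AT); apply: contraNN UK0 => /eqP K0.
      by rewrite -subv0 -K0 capvSr.
    apply/lfunP => u; rewrite scale_lfunE id_lfunE; apply: val_inj.
    rewrite [LHS]lrestrE ?PU //=.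
    have: g (vsval u) \in (g @: U)%VS by rewrite memv_img ?subvsP.
    by rewrite gU0 memv0 gE lfunE subr_eq0 => /eqP.
  (* The direct sum lies in [U], and by rank-nullity for [g] on [U] it has the dimension of [U]. *)
  - apply/eqP; rewrite eqEdim subv_add capvSl gU dimv_disjoint_sum //.
    by rewrite limg_ker_dim leqnn.
pose V (i : 'I_(size s)) := tnth (in_tuple s) i.
have sV i : [/\ V i != 0%VS, P (V i) & Q (V i)] by apply/sP/mem_tnth.
exists (size s), V; split=> [i|i T|| i T]; try by have [] := sV i.
  by have [_ /(_ T)] := sV i.
  have sumV : (\sum_i V i)%VS = fullv by rewrite -sum_s (big_tnth _ _ s).
  (* A sum is direct exactly when its dimension is the sum of the dimensions, which is what [dim_s]
     says. *)
  have dxV : directv (\sum_i V i)%VS.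
    by rewrite directvE /= sumV -dim_s (big_tnth _ _ s).
  by split=> [i|]; rewrite ?sumV //; have /directv_sumP-> := dxV.
by have [_ _ /(_ T)] := sV i.
Qed.
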